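(* Let $X$ be a finite simplicial complex whose simplices are partitioned into pairwise disjoint families $X_1,\ldots,X_k$ such that $X_1\cup\cdots\cup X_\ell$ is a subcomplex of $X$ for $\ell=1,\ldots,k-1$, and such that for each $\ell=1,\ldots,k$ there is an acyclic matching $\mathcal{P}_\ell$ on $X_\ell$. Assume $X$ is a subcomplex of a larger complex $Y$ whose simplices are also partitioned into pairwise disjoint families $Y_1,\ldots,Y_k$ satisfying the following three conditions: (i) $Y_\ell\cap X=X_\ell$ for $\ell=1,\ldots,k$. (ii) $Y_1\cup\cdots\cup Y_\ell$ is a subcomplex of $Y$ for $\ell=1,\ldots,k-1$. (iii) For $\ell=1,\ldots,k$ there is a matching $\mathcal{Q}_\ell$ on $Y_\ell$ (not assumed acyclic) which restricts to $\mathcal{P}_\ell$ on $X_\ell$, in the sense that (a) two simplices of $X_\ell$ form a $\mathcal{P}_\ell$-matched pair if and only if they form a $\mathcal{Q}_\ell$-matched pair, and (b) no simplex of $X_\ell$ is $\mathcal{Q}_\ell$-matched to a simplex of $Y_\ell\setminus X_\ell$. Assume in addition that, for each $\ell=1,\ldots,k$, there are no directed $\mathcal{Q}_\ell$-cycles in $Y_\ell\setminus X_\ell$. Then each $\mathcal{Q}_\ell$ is acyclic, and $\mathcal{Q}:=\bigcup_{1\le\ell\le k}\mathcal{Q}_\ell$ is an acyclic matching on $Y$.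
   Context: A matching on a family $\mathcal{S}$ of simplices of a simplicial complex is a set of pairs $(\beta,\alpha)$ with $\beta,\alpha\in\mathcal{S}$, $\beta\subset\alpha$, $\dim\alpha=\dim\beta+1$, such that each simplex belongs to at most one pair; a matched pair is written $\beta\nearrow\alpha$. For simplices $\beta\subset\alpha$ of $\mathcal{S}$ with $\dim\alpha=\dim\beta+1$ that are not a matched pair, write $\alpha\searrow\beta$. (These arrows are the edges of the modified Hasse diagram, obtained from the Hasse diagram of the face poset by reversing the matching edges.) A directed path in $\mathcal{S}$ with respect to the matching is a sequence $\tau_0\nearrow\sigma_1\searrow\tau_1\nearrow\cdots\nearrow\sigma_k\searrow\tau_k$ of simplices of $\mathcal{S}$; it is a (directed) cycle if $k>0$, $\tau_0=\tau_k$ and $\tau_1,\ldots,\tau_k$ are pairwise distinct. The matching is acyclic if there are no directed cycles. A directed $\mathcal{Q}_\ell$-cycle in $Y_\ell\setminus X_\ell$ is a directed cycle with respect to $\mathcal{Q}_\ell$ all of whose simplices lie in $Y_\ell\setminus X_\ell$. *)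

(* Defs.v *)
From mathcomp Require Import all_boot all_order all_algebra.
From mathcomp Require Import finmap.
From mathcomp Require Import classical_sets cardinality.

Set Implicit Arguments.
Unset Strict Implicit.
Unset Printing Implicit Defensive.

Local Open Scope classical_set_scope.

Section Complexes.
Variable V : choiceType.
Implicit Types (K L : set {fset V}) (s t : {fset V}).

(* Abstract, possibly infinite, complexes: simplices are nonempty finite sets
   of vertices. The empty complex is allowed. *)
Definition simplicial_complex K : Prop :=
  (forall s, K s -> s != fset0) /\
  (forall s t, K s -> t != fset0 -> (t `<=` s)%fset -> K t).

Definition subcomplex L K : Prop := simplicial_complex L /\ L `<=` K.

(* Integer-valued, so that the empty set has dimension -1 rather than 0. *)
Definition dim s : int := ((#|` s|)%:Z - 1)%R.

Definition facet (beta alpha : {fset V}) : Prop :=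
  (beta `<=` alpha)%fset /\ dim alpha = (dim beta + 1)%R.

End Complexes.

Section Matchings.
Variable V : choiceType.
Implicit Types (S D : set {fset V}) (M : set ({fset V} * {fset V})).
Implicit Types (s t alpha beta : {fset V}) (tau sigma : nat -> {fset V}).

(* A matched pair is stored as (beta, alpha), the smaller simplex first. *)
Definition matching S M : Prop :=
  (forall beta alpha, M (beta, alpha) ->
     [/\ S beta, S alpha & facet beta alpha]) /\
  (forall s p q, M p -> M q ->
     s = p.1 \/ s = p.2 -> s = q.1 \/ s = q.2 -> p = q).

Definition matched M s t : Prop := M (s, t) \/ M (t, s).

Definition arrow_up M beta alpha : Prop := M (beta, alpha).

Definition arrow_down M alpha beta : Prop :=
  facet beta alpha /\ ~ M (beta, alpha).

(* The sequence tau_0, sigma_1, tau_1, ..., sigma_n, tau_n is given by the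
   values tau i for i <= n and sigma i for 1 <= i <= n; the other values of
   tau and sigma are irrelevant. *)
Definition lies_in D (n : nat) tau sigma : Prop :=
  (forall i, (i <= n)%N -> D (tau i)) /\
  (forall i, (1 <= i <= n)%N -> D (sigma i)).

Definition directed_path S M (n : nat) tau sigma : Prop :=
  lies_in S n tau sigma /\
  (forall i, (i < n)%N ->
     arrow_up M (tau i) (sigma i.+1) /\
     arrow_down M (sigma i.+1) (tau i.+1)).

Definition directed_cycle S M (n : nat) tau sigma : Prop :=
  [/\ directed_path S M n tau sigma,
      (0 < n)%N,
      tau 0%N = tau n &
      forall i j, (1 <= i <= n)%N -> (1 <= j <= n)%N ->
        tau i = tau j -> i = j].

Definition acyclic S M : Prop :=
  forall n tau sigma, ~ directed_cycle S M n tau sigma.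

Definition restricts_to S (Q : set ({fset V} * {fset V}))
    S' (P : set ({fset V} * {fset V})) : Prop :=
  (forall s t, S' s -> S' t -> (matched P s t <-> matched Q s t)) /\
  (forall s t, S' s -> (S `\` S') t -> ~ matched Q s t).

End Matchings.

(* Main.v *)
(* Along a directed path neither the index of the stratum nor membership in the
   complement of X can be regained once lost: a matched pair lies in a single
   stratum and is inside X or outside X, and passing to a face can only lower
   the stratum index or enter X. Around a cycle both are therefore constant, so
   a cycle of the union is a cycle of some single matching, lying entirely in X
   or entirely outside X. *)
Require Import Defs.
From mathcomp Require Import all_boot all_order all_algebra.
From mathcomp Require Import finmap.
From mathcomp Require Import boolp classical_sets cardinality.

Local Open Scope classical_set_scope.

(** Walk forward from [i] to [n], jump back to [0] through [f 0 = f n], then walk forward again up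
    to [j]: persistence in one direction is enough on a closed sequence. *)
Lemma cyclic_invariant (T : Type) (A : T -> Prop) (n : nat) (f : nat -> T) :
  f 0%N = f n ->
  (forall i, (i < n)%N -> A (f i) -> A (f i.+1)) ->
  forall i j, (i <= n)%N -> (j <= n)%N -> A (f i) -> A (f j).
Proof.
move=> f0n stepA.
have up i d : (i + d <= n)%N -> A (f i) -> A (f (i + d)%N).
  elim: d => [|d IHd]; first by rewrite addn0.
  rewrite addnS => le_n Ai; apply: stepA => //.
  by apply: IHd => //; exact: ltnW.
move=> i j le_in le_jn Ai.
have An : A (f n) by rewrite -(subnKC le_in); apply: up => //; rewrite subnKC.
by rewrite -(add0n j); apply: up; rewrite ?add0n // f0n.
Qed.

Section OneMatching.
Context {V : choiceType}.
Implicit Types (S D : set {fset V}) (M : set ({fset V} * {fset V})).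

Lemma facet_asym (s t : {fset V}) : facet s t -> ~ facet t s.
Proof.
move=> [_ dim_t] [_]; rewrite dim_t -GRing.addrA => /eqP.
by rewrite -GRing.subr_eq0 GRing.opprD GRing.addNKr.
Qed.

(** Bridges [restricts_to], which compares unordered pairs, and arrows, which are oriented:
    dimension leaves only one possible order. *)
Lemma matched_arrow_up S M (s t : {fset V}) :
  matching S M -> facet s t -> matched M s t -> arrow_up M s t.
Proof.
move=> [edgeM _] fst [//|/edgeM [_ _ fts]].
by case: (facet_asym s t).
Qed.

Lemma matching_mem S M (p : {fset V} * {fset V}) (s : {fset V}) :
  matching S M -> M p -> s = p.1 \/ s = p.2 -> S s.
Proof. by move: p => [b a] [edgeM _] /edgeM [? ? _] [] ->. Qed.

Lemma lies_in_steps D n (tau sigma : nat -> {fset V}) :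
  (forall i, (i <= n)%N -> D (tau i)) ->
  (forall i, (i < n)%N -> D (tau i) -> D (sigma i.+1)) ->
  lies_in D n tau sigma.
Proof.
move=> Dtau Dsigma; split=> // -[//|i] /= lt_in.
by apply: Dsigma => //; apply: Dtau; exact: ltnW.
Qed.

(** Positive length, closedness and distinctness mention neither the family nor the matching, so
    only membership and arrows have to be rechecked. *)
Lemma directed_cycle_transfer {S M} S' M' {n} {tau sigma : nat -> {fset V}} :
  directed_cycle S M n tau sigma ->
  lies_in S' n tau sigma ->
  (forall i, (i < n)%N -> arrow_up M (tau i) (sigma i.+1) ->
     arrow_up M' (tau i) (sigma i.+1)) ->
  (forall i, (i < n)%N -> arrow_down M (sigma i.+1) (tau i.+1) ->
     arrow_down M' (sigma i.+1) (tau i.+1)) ->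
  directed_cycle S' M' n tau sigma.
Proof.
move=> [[_ steps] n_gt0 closed simple] inS' up down; split=> //; split=> // i lt_in.
have [stepup stepdown] := steps i lt_in.
by split; [exact: up | exact: down].
Qed.

(** Treats a single stratum [S] of the larger complex, with trace [S'] on [X]. A cycle that meets
    [S'] stays there and is a cycle of [P]; one that avoids [S'] is excluded by assumption. *)
Lemma acyclic_extension (X S S' : set {fset V})
    (Q P : set ({fset V} * {fset V})) :
  simplicial_complex X ->
  (forall s, S s -> s != fset0) ->
  S `&` X = S' ->
  matching S Q -> matching S' P -> restricts_to S Q S' P ->
  acyclic S' P ->
  (~ exists n tau sigma, directed_cycle S Q n tau sigma /\
                         lies_in (S `\` S') n tau sigma) ->
  acyclic S Q.
Proof.
move=> [_ faceX] Sn0 eS' mQ mP [resP resN] acP ncyc n tau sigma cyc.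
have [[[Stau Ssig] steps] n_gt0 closed _] := cyc.
have S'X s : S s -> X s -> S' s by rewrite -eS'; split.
have sig1 i : (i < n)%N -> S (sigma i.+1) by move=> lt_in; apply: Ssig.
have tauL i : (i < n)%N -> S (tau i) by move=> lt_in; apply: Stau; exact: ltnW.
have sigP i : (i < n)%N -> S' (tau i) -> S' (sigma i.+1).
  move=> lt_in S't; apply: contrapT => nS's.
  have [up _] := steps i lt_in.
  by apply: (resN _ _ S't (conj (sig1 i lt_in) nS's)); left.
have sigN i : (i < n)%N -> ~ S' (tau i) -> ~ S' (sigma i.+1).
  move=> lt_in nS't S's; have [up _] := steps i lt_in.
  by apply: (resN _ _ S's (conj (tauL i lt_in) nS't)); right.
(* [S'] itself need not be closed under faces: the descent uses closure of [X], and [tau i.+1] being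
   in [S] brings it back to [S']. *)
have tauP i : (i < n)%N -> S' (tau i) -> S' (tau i.+1).
  move=> lt_in /(sigP i lt_in); have [_ [[sub _] _]] := steps i lt_in.
  rewrite -{1}eS' => -[_ Xs]; have St := Stau i.+1 lt_in.
  by apply: S'X => //; apply: faceX Xs _ sub; exact: Sn0.
have inv := cyclic_invariant _ S' n tau closed tauP.
case: (EM (S' (tau 0%N))) => [S't0|nS't0].
- have S'tau i : (i <= n)%N -> S' (tau i) by move=> le_in; exact: inv S't0.
  apply: (acP n tau sigma); apply: (directed_cycle_transfer S' P cyc).
  + exact: lies_in_steps.
  + move=> i lt_in up; have S't := S'tau i (ltnW lt_in).
    have [/(_ _ _ up) [_ _ fac] _] := mQ.
    apply: (matched_arrow_up _ _ _ _ mP fac).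
    by apply/resP => //; [exact: sigP | left].
  (* A down arrow is a non-match, so the restriction property is now used in the other direction,
     from [P] to [Q]. *)
  + move=> i lt_in [fac nQ]; split=> // Pts; apply: nQ.
    apply: (matched_arrow_up _ _ _ _ mQ fac).
    apply/resP; [exact: S'tau | by apply: sigP => //; exact/S'tau/ltnW | by left].
- apply: ncyc; exists n, tau, sigma; split=> //; apply: lies_in_steps.
  (* Here [inv] carries membership in [S'] from [i] round to [0]. *)
  + by move=> i le_in; split; [exact: Stau | move=> S't; apply: nS't0; exact: inv S't].
  + by move=> i lt_in [_ nS't]; split; [exact: sig1 | exact: sigN].
Qed.

End OneMatching.

Section Filtration.
Context {V : choiceType} (k : nat) (Y : set {fset V}).
Context (Y_ : 'I_k -> set {fset V}) (Q_ : 'I_k -> set ({fset V} * {fset V})).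
Context (Ycover : Y = \bigcup_l Y_ l).
Context (Ydisj : trivIset setT Y_).
Context (Qmatch : forall l, matching (Y_ l) (Q_ l)).

Lemma stratum_inj s a b : Y_ a s -> Y_ b s -> a = b.
Proof. by move=> Yas Ybs; apply: Ydisj => //; exists s. Qed.

(** A shared simplex lies in one stratum only, so both pairs come from the same [Q_ l]. *)
Lemma bigcup_matching : matching Y (\bigcup_l Q_ l).
Proof.
split=> [b a [l _ Qba]|s p q [a _ Qp] [b _ Qq] sp sq].
  have [Yb Ya fac] := (Qmatch l).1 _ _ Qba.
  by split=> //; rewrite Ycover; exists l.
have Yas := matching_mem _ _ _ _ (Qmatch a) Qp sp.
have Ybs := matching_mem _ _ _ _ (Qmatch b) Qq sq.
have eab := stratum_inj _ _ _ Yas Ybs; rewrite -{}eab in Qq.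
exact: (Qmatch a).2 Qp Qq sp sq.
Qed.

Context (Yn0 : forall s, Y s -> s != fset0).
Context (Ysub : forall l : 'I_k, (l.+1 < k)%N ->
  subcomplex (\bigcup_(j in [set j : 'I_k | (j <= l)%N]) Y_ j) Y).

Lemma face_lower_stratum l s t :
  Y_ l s -> Y t -> (t `<=` s)%fset ->
  exists2 j : 'I_k, (j <= l)%N & Y_ j t.
Proof.
(* The subcomplex hypothesis stops before the last index; there every stratum index is at most [l],
   and the cover suffices. *)
move=> Yls Yt ts; case: (ltnP l.+1 k) => [lt_lk|le_kl].
  have [[_ face] _] := Ysub _ lt_lk.
  have [|j /= le_jl Yjt] := face s t _ (Yn0 _ Yt) ts; last by exists j.
  by exists l => /=.
move: Yt; rewrite Ycover => -[j _ Yjt]; exists j => //.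
by rewrite -ltnS; exact: leq_trans (ltn_ord j) le_kl.
Qed.

Lemma bigcup_acyclic :
  (forall l, acyclic (Y_ l) (Q_ l)) -> acyclic Y (\bigcup_l Q_ l).
Proof.
move=> acQ n tau sigma cyc.
have [[[Ytau _] steps] n_gt0 closed _] := cyc.
have same_stratum i l : (i < n)%N -> Y_ l (tau i) ->
    Q_ l (tau i, sigma i.+1) /\ Y_ l (sigma i.+1).
  move=> lt_in Ylt; have [[a _ Qts] _] := steps i lt_in.
  have [Yat Yas _] := (Qmatch a).1 _ _ Qts.
  by rewrite (stratum_inj _ _ _ Ylt Yat).
(* Sublevel unions of strata turn the decreasing index into a property that persists forward, one
   for each bound [m]. *)
pose U m (s : {fset V}) := exists2 j : 'I_k, (j <= m)%N & Y_ j s.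
have stepU m i : (i < n)%N -> U m (tau i) -> U m (tau i.+1).
  move=> lt_in [j le_jm Yjt]; have [_ Yjs] := same_stratum i j lt_in Yjt.
  have [_ [[sub _] _]] := steps i lt_in.
  have [j' le_j'j Yj't] := face_lower_stratum _ _ _ Yjs (Ytau _ lt_in) sub.
  by exists j' => //; exact: leq_trans le_jm.
have inv m := cyclic_invariant _ (U m) n tau closed (stepU m).
have := Ytau 0%N (leq0n n); rewrite {1}Ycover => -[l _ Yl0].
have Yl i : (i <= n)%N -> Y_ l (tau i).
  move=> le_in.
  (* Invariance at level [l] gives [j <= l]; invariance at level [j], from [i] round to [0], gives
     [l <= j]. *)
  have [|j le_jl Yji] := inv l 0%N i (leq0n n) le_in; first by exists l.
  have [|j' le_j'j Yj'0] := inv j i 0%N le_in (leq0n n); first by exists j.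
  have ej' := stratum_inj _ _ _ Yj'0 Yl0; rewrite {}ej' in le_j'j.
  suff -> : l = j by [].
  by apply/val_inj/eqP; rewrite eqn_leq le_j'j.
apply: (acQ l n tau sigma); apply: (directed_cycle_transfer (Y_ l) (Q_ l) cyc).
- apply: lies_in_steps => // i lt_in Ylt.
  by have [] := same_stratum i l lt_in Ylt.
- by move=> i lt_in _; have [] := same_stratum i l lt_in (Yl i (ltnW lt_in)).
(* A pair outside the union is outside each [Q_ l]. *)
- by move=> i lt_in [fac nQ]; split=> // Qts; apply: nQ; exists l.
Qed.

End Filtration.

(* The families X_1, ..., X_k are indexed by 'I_k, that is, from 0 to k - 1. *)
Theorem proposition3p3 (V : choiceType) (k : nat)
    (X Y : set {fset V})
    (X_ Y_ : 'I_k -> set {fset V})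
    (P_ Q_ : 'I_k -> set ({fset V} * {fset V}))
    (hX : simplicial_complex X)
    (hXfin : finite_set X)
    (hXcover : X = \bigcup_l X_ l)
    (hXdisj : trivIset setT X_)
    (hXsub : forall l : 'I_k, (l.+1 < k)%N ->
       subcomplex (\bigcup_(j in [set j : 'I_k | (j <= l)%N]) X_ j) X)
    (hPmatch : forall l : 'I_k, matching (X_ l) (P_ l))
    (hPacyc : forall l : 'I_k, acyclic (X_ l) (P_ l))
    (hY : simplicial_complex Y)
    (hXY : subcomplex X Y)
    (hYcover : Y = \bigcup_l Y_ l)
    (hYdisj : trivIset setT Y_)
    (hi : forall l : 'I_k, Y_ l `&` X = X_ l)
    (hii : forall l : 'I_k, (l.+1 < k)%N ->
       subcomplex (\bigcup_(j in [set j : 'I_k | (j <= l)%N]) Y_ j) Y)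
    (hQmatch : forall l : 'I_k, matching (Y_ l) (Q_ l))
    (hiii : forall l : 'I_k, restricts_to (Y_ l) (Q_ l) (X_ l) (P_ l))
    (hQcyc : forall l : 'I_k,
       ~ exists n tau sigma, directed_cycle (Y_ l) (Q_ l) n tau sigma /\
                             lies_in (Y_ l `\` X_ l) n tau sigma) :
  (forall l : 'I_k, acyclic (Y_ l) (Q_ l)) /\
  (matching Y (\bigcup_l Q_ l) /\ acyclic Y (\bigcup_l Q_ l)).
Proof.
have Yn0 s : Y s -> s != fset0 by case: hY => n0 _; exact: n0.
have acQ l : acyclic (Y_ l) (Q_ l).
  apply: (acyclic_extension X (Y_ l) (X_ l) (Q_ l) (P_ l)) => //.
  by move=> s Yls; apply: Yn0; rewrite hYcover; exists l.
by split=> //; split; [exact: (bigcup_matching k Y Y_) | exact: (bigcup_acyclic k Y Y_)].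
Qed.
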